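(* Let $\tau>0$ and let $\lambda,\gamma,\eta\in\mathbb{C}$ be such that $\lambda=a+ib$ with $a\in\mathbb{R}$, $a\leq\frac{1}{\tau}$, $b\in\mathbb{R}$. Let $\Lambda_{\tau,a}\subset\mathbb{C}$ be the set corresponding to $\tau$ and $a$. Then: (i) every solution $s\in\mathbb{C}$ of the equation $s-a-\eta e^{-s\tau}=0$ belongs to $\mathbb{C}_-$ if and only if $\eta\in\Lambda_{\tau,a}$; (ii) every solution $s\in\mathbb{C}$ of $$s-\lambda-\gamma e^{-s\tau}=0$$ and of its version with conjugate coefficients $$s-\overline{\lambda}-\overline{\gamma}e^{-s\tau}=0$$ belongs to $\mathbb{C}_-$ if and only if $\gamma e^{-ib\tau}\in\Lambda_{\tau,a}$.
   Context: Notation: $\mathbb{C}_-=\{s\in\mathbb{C}:\operatorname{Re}(s)<0\}$; $\mathbb{D}_r\subset\mathbb{C}$ is the open disc centred at $0$ with radius $r>0$; $\operatorname{Arg}$ is the principal argument, with values in $(-\pi,\pi]$; $\arctan$ is the real arctangent with values in $(-\frac{\pi}{2},\frac{\pi}{2})$. For $\tau>0$ and $a\in(-\infty,\frac1\tau]$ the set $\Lambda_{\tau,a}\subset\mathbb{C}$ is defined as follows. (1) For $a<0$: $$\Lambda_{\tau,a}:=\Big\{\eta\in\mathbb{C}\setminus\mathbb{D}_{|a|}:\ \operatorname{Re}\eta+a<0,\ |\eta|<|\eta_\pi|,\ |\operatorname{Arg}\eta|>\tau\sqrt{|\eta|^2-a^2}+\arctan\Big(-\frac1a\sqrt{|\eta|^2-a^2}\Big)\Big\}\cup\mathbb{D}_{|a|},$$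 where $\eta_\pi$ is such that $\tau\sqrt{|\eta_\pi|^2-a^2}+\arctan\big(-\frac1a\sqrt{|\eta_\pi|^2-a^2}\big)=\pi$. (2) For $a=0$: $$\Lambda_{\tau,0}:=\Big\{\eta\in\mathbb{C}\setminus\{0\}:\ \operatorname{Re}\eta<0,\ |\eta|<\frac{\pi}{2\tau},\ |\operatorname{Arg}\eta|>\tau|\eta|+\frac{\pi}{2}\Big\}.$$ (3) For $0<a\leq\frac1\tau$: $$\Lambda_{\tau,a}:=\Big\{\eta\in\mathbb{C}:\ \operatorname{Re}\eta+a<0,\ |\eta|<|\eta_\pi|,\ |\operatorname{Arg}\eta|>\tau\sqrt{|\eta|^2-a^2}+\arctan\Big(-\frac1a\sqrt{|\eta|^2-a^2}\Big)+\pi\Big\},$$ where $\eta_\pi$ is such that $|\eta_\pi|>a$ and $\tau\sqrt{|\eta_\pi|^2-a^2}+\arctan\big(-\frac1a\sqrt{|\eta_\pi|^2-a^2}\big)=0$. *)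

(* Defs.v *)
From Stdlib Require Import Reals Lra.
From Coquelicot Require Import Coquelicot.
Open Scope R_scope.

Definition Cexp (z : C) : C :=
  (exp (Re z) * cos (Im z), exp (Re z) * sin (Im z)).

(* Principal argument, with values in (-PI, PI]; see [Arg_spec].
   The value at 0 is irrelevant. *)
Definition Arg (z : C) : R :=
  if Rle_dec 0 (Im z) then acos (Re z / Cmod z) else - acos (Re z / Cmod z).

Definition left_half_plane (s : C) : Prop := Re s < 0.

Definition disc (r : R) (z : C) : Prop := Cmod z < r.

(* Only meaningful for a <> 0 and |a| <= |eta|: Stdlib's [sqrt] vanishes on
   negative numbers and [1 / 0] carries no information. *)
Definition phase (tau a : R) (eta : C) : R :=
  tau * sqrt (Cmod eta ^ 2 - a ^ 2)
  + atan (- (1 / a) * sqrt (Cmod eta ^ 2 - a ^ 2)).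

(* The points [eta_pi] below are determined only up to their modulus, which is
   all that is used.  When a = 1 / tau, no [eta_pi] as in [Lambda_pos] exists,
   and [Lambda_pos] is then empty; it would be empty even without the bound on
   the modulus, since [phase] is nonnegative in that case. *)
Definition Lambda_neg (tau a : R) (eta : C) : Prop :=
  (~ disc (Rabs a) eta /\
   Re eta + a < 0 /\
   (exists eta_pi : C, phase tau a eta_pi = PI /\ Cmod eta < Cmod eta_pi) /\
   Rabs (Arg eta) > phase tau a eta)
  \/ disc (Rabs a) eta.

Definition Lambda_zero (tau : R) (eta : C) : Prop :=
  eta <> 0%C /\
  Re eta < 0 /\
  Cmod eta < PI / (2 * tau) /\
  Rabs (Arg eta) > tau * Cmod eta + PI / 2.

Definition Lambda_pos (tau a : R) (eta : C) : Prop :=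
  Re eta + a < 0 /\
  (exists eta_pi : C,
     Cmod eta_pi > a /\ phase tau a eta_pi = 0 /\ Cmod eta < Cmod eta_pi) /\
  Rabs (Arg eta) > phase tau a eta + PI.

Definition Lambda (tau a : R) (eta : C) : Prop :=
  (a < 0 /\ Lambda_neg tau a eta) \/
  (a = 0 /\ Lambda_zero tau eta) \/
  (0 < a <= 1 / tau /\ Lambda_pos tau a eta).

Lemma Arg_spec (z : C) : z <> 0%C ->
  - PI < Arg z <= PI /\
  z = (Cmod z * cos (Arg z), Cmod z * sin (Arg z)).
Proof.
  intros Hz.
  assert (Hm : 0 < Cmod z) by now apply Cmod_gt_0.
  assert (Hsq : Cmod z * Cmod z = Re z * Re z + Im z * Im z).
  { unfold Cmod, Re, Im. rewrite sqrt_sqrt; [ring | nra]. }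
  set (m := Cmod z) in *. set (q := Re z / m).
  assert (Hq : q * m = Re z) by (unfold q; field; lra).
  assert (Hqm : (1 - q²) * (m * m) = Im z * Im z).
  { unfold Rsqr. replace ((1 - q * q) * (m * m)) with (m * m - (q * m) * (q * m))
      by ring. rewrite Hq. lra. }
  assert (Hq1 : 0 <= 1 - q²).
  { apply Rmult_le_reg_r with (m * m); nra. }
  assert (Hqb : -1 <= q <= 1) by (unfold Rsqr in Hq1; nra).
  assert (Hs : m * sqrt (1 - q²) = Rabs (Im z)).
  { rewrite <- (sqrt_Rsqr m) at 1 by lra.
    rewrite <- sqrt_mult by (try apply Rle_0_sqr; lra).
    rewrite <- sqrt_Rsqr_abs. f_equal. unfold Rsqr in *. lra. }
  pose proof (acos_bound q) as Hb. pose proof PI_RGT_0 as Hpi.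
  unfold Arg. fold m. fold q.
  destruct (Rle_dec 0 (Im z)) as [Hi | Hi].
  - split; [lra |].
    rewrite cos_acos, sin_acos, Hs, Rabs_pos_eq by lra.
    rewrite Rmult_comm, Hq. now destruct z.
  - assert (Hi' : Im z < 0) by lra.
    assert (acos q <> PI).
    { intros E. assert (Hc := cos_acos q Hqb). rewrite E, cos_PI in Hc.
      rewrite <- Hc in Hqm. unfold Rsqr in Hqm. nra. }
    split; [lra |].
    rewrite cos_neg, sin_neg, cos_acos, sin_acos by lra.
    replace (m * - sqrt (1 - q²)) with (- (m * sqrt (1 - q²))) by ring.
    rewrite Hs, Rabs_left, Ropp_involutive by lra.
    rewrite Rmult_comm, Hq. now destruct z.
Qed.

(* Main.v *)
Require Import Defs.
From Stdlib Require Import Reals Lra.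
From Coquelicot Require Import Coquelicot.
Open Scope R_scope.

(** Write the equation as [eta = (s - a) e^(s tau)] and let [rho = |eta|].  The
    equality of moduli puts [s] on the curve [|s - a| e^(tau Re s) = rho], on which
    [|Im s|] is a function of [x = Re s].  In the closed upper half plane the
    argument of the right-hand side along this curve is
    [[
      root_phase tau a rho x = tau * |Im s| + acos ((x - a) e^(tau x) / rho),
    ]]
    and, up to conjugation, [s] is a root exactly when this angle agrees with
    [Rabs (Arg eta)] modulo sign and [2 PI].

    Since [a <= 1 / tau], the function [(x - a) e^(tau x)] increases on [x >= 0],
    so the part of the curve in [Re s >= 0] lies over an interval, which is empty
    if [rho < - a]. At the right end of the interval the phase is [0]. At the left
    end it is either the phase at [x = 0], on the imaginary axis, or [PI], if the
    curve closes up before reaching the axis; the saturated formula gives [PI] at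
    [x = 0] too in this case. By the intermediate value theorem all angles between
    [0] and the phase at [0] occur ([exists_unstable_root]). Conversely the phase
    decreases in [x] ([root_phase_le]), so no other angle occurs. Hence, for [eta
    <> 0], all roots are in the open left half plane exactly when the curve misses
    [Re s >= 0], which is [rho < - a], or [Rabs (Arg eta)] exceeds the phase at
    [0] ([stable_iff]).

    For [|eta| >= |a|] the phase at [0] is the bound on [Rabs (Arg eta)] that
    occurs in each of the three cases of [Lambda], and the other conditions there
    follow from this bound ([Lambda_iff]).  The pair of equations with coefficients
    [lambda], [gamma] and their conjugates reduces to the equation with real [a] by
    the translation [s -> s + i b] and by conjugation, which both respect the left
    half plane. *)

(** * The arccosine at the end points *)

(** Outside [-1, 1] the arccosine is constant, so it is continuous on the whole
    line.  At 1 this comes from the formula with the arctangent of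
    [sqrt (1 - t²) / t], valid for all positive [t], and the reflection
    [acos (- t) = PI - acos t] carries it to the negative side. *)
Lemma continuous_acos (x : R) : continuous acos x.
Proof.
  assert (Hpos : forall y, 0 < y -> continuous acos y).
  { intros y Hy.
    apply continuous_ext_loc with (fun t => atan (sqrt (1 - t²) / t)).
    - exists (mkposreal y Hy). intros t Ht. symmetry. apply acos_atan.
      apply Rabs_lt_between' in Ht. simpl in Ht. lra.
    - apply continuous_comp.
      + unfold Rdiv. apply (continuous_mult (K := R_AbsRing)).
        * apply continuous_sqrt_comp.
          apply (ex_derive_continuous (V := R_NormedModule)). unfold Rsqr. now auto_derive.
        * apply (ex_derive_continuous (V := R_NormedModule)). auto_derive. lra.
      + apply continuity_pt_filterlim, derivable_continuous_pt, derivable_pt_atan. }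
  destruct (Rtotal_order x 0) as [Hx | [-> | Hx]].
  - apply continuous_ext with (fun t => PI - acos (- t)).
    { intros t. rewrite acos_opp. simpl. lra. }
    apply (continuous_minus (V := R_NormedModule)); [apply continuous_const |].
    apply (continuous_comp Ropp acos).
    + apply (continuous_opp (V := R_NormedModule)), continuous_id.
    + apply Hpos. lra.
  - apply continuity_pt_filterlim, derivable_continuous_pt, derivable_pt_acos. lra.
  - now apply Hpos.
Qed.

Lemma is_derive_acos (x : R) : -1 < x < 1 -> is_derive acos x (- / sqrt (1 - x²)).
Proof.
  intros Hx. apply is_derive_Reals.
  replace (- / sqrt (1 - x²)) with (derive_pt acos x (derivable_pt_acos x Hx)).
  - apply (proj2_sig (derivable_pt_acos x Hx)).
  - rewrite derive_pt_acos. unfold Rdiv. ring.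
Qed.

(** * The phase of a root with given real part *)

(** The only coefficient [eta] for which the real number [x] is a root.  For a
    root with real part [x] and [Cmod eta = rho], [real_eta tau a x / rho] is the
    cosine of the argument of [s - a]. *)
Definition real_eta (tau a x : R) : R := (x - a) * exp (tau * x).

(** The argument of [(s - a) e^(s tau)] at the point [s] in the closed upper half
    plane with real part [x] at which this product has modulus [rho]; see
    [root_phase_polar].  It is not reduced modulo [2 PI], hence continuous in
    [x].  When [|real_eta tau a x| > rho] there is no such point; the square root
    and the arccosine then saturate, which keeps the function continuous on the
    whole line. *)
Definition root_phase (tau a rho x : R) : R :=
  tau * (exp (- (tau * x)) * sqrt (rho ^ 2 - real_eta tau a x ^ 2))
  + acos (real_eta tau a x / rho).

Lemma real_eta_0 (tau a : R) : real_eta tau a 0 = - a.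
Proof. unfold real_eta. rewrite Rmult_0_r, exp_0. ring. Qed.

Lemma continuity_real_eta (tau a : R) : continuity (real_eta tau a).
Proof.
  intros x. apply continuity_pt_filterlim.
  apply (ex_derive_continuous (V := R_NormedModule)). unfold real_eta. now auto_derive.
Qed.

Lemma continuity_root_phase (tau a rho : R) : continuity (root_phase tau a rho).
Proof.
  intros x. apply continuity_pt_plus.
  - apply continuity_pt_mult; [now apply continuity_pt_const |].
    apply continuity_pt_mult; apply continuity_pt_filterlim.
    + apply (ex_derive_continuous (V := R_NormedModule) (fun t => exp (- (tau * t)))).
      now auto_derive.
    + apply (continuous_sqrt_comp (fun t => rho ^ 2 - real_eta tau a t ^ 2)).
      apply (ex_derive_continuous (V := R_NormedModule)). unfold real_eta. now auto_derive.
  - apply (continuity_pt_comp (fun t => real_eta tau a t / rho) acos).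
    + apply continuity_pt_filterlim.
      apply (ex_derive_continuous (V := R_NormedModule) (fun t => real_eta tau a t / rho)).
      unfold real_eta. now auto_derive.
    + apply continuity_pt_filterlim, continuous_acos.
Qed.

(** The derivative is [(1 + tau (x - a)) e^(tau x)], which is positive for [x > 0]
    because [a <= 1 / tau]. *)
Lemma real_eta_increasing (tau a x y : R) :
  0 < tau -> a * tau <= 1 -> 0 <= x -> x < y -> real_eta tau a x < real_eta tau a y.
Proof.
  intros Ht Ha Hx Hxy. unfold real_eta.
  replace (tau * x) with (tau * y + - (tau * (y - x))) by ring.
  rewrite exp_plus.
  (* After division by [exp (tau * y)] only the bounds [1 - t < exp (- t) < 1]
     at [t = tau * (y - x)] are needed. *)
  pose proof (exp_pos (tau * y)) as HE.
  assert (Hd : 0 < tau * (y - x)) by (apply Rmult_lt_0_compat; lra).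
  assert (H1 : 1 - tau * (y - x) < exp (- (tau * (y - x)))).
  { assert (H := exp_ineq1 (- (tau * (y - x)))). lra. }
  pose proof (exp_pos (- (tau * (y - x)))) as He0.
  assert (H2 : exp (- (tau * (y - x))) < 1).
  { rewrite <- exp_0. apply exp_increasing. lra. }
  set (e := exp (- (tau * (y - x)))) in *.
  enough (Hk : (x - a) * e < y - a).
  { replace ((x - a) * (exp (tau * y) * e)) with (((x - a) * e) * exp (tau * y)) by ring.
    now apply Rmult_lt_compat_r. }
  destruct (Rle_dec 0 (x - a)) as [Hs | Hs].
  - nra.
  - assert (tau * (a - x) <= 1) by nra.
    assert ((x - a) * e < (x - a) * (1 - tau * (y - x))) by nra.
    assert (tau * (a - x) * (y - x) <= 1 * (y - x)) by (apply Rmult_le_compat_r; lra).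
    nra.
Qed.

(** With [E = exp (- tau x)] and [h = real_eta tau a x], the numerator is at most
    [- (tau E h + 1)^2] because [h^2 < rho^2]; this is what makes the phase
    monotone. *)
Lemma is_derive_root_phase (tau a rho x : R) :
  0 < rho -> - rho < real_eta tau a x < rho ->
  is_derive (root_phase tau a rho) x
    (- (tau ^ 2 * exp (- (tau * x)) ^ 2 * rho ^ 2
        + 2 * tau * exp (- (tau * x)) * real_eta tau a x + 1)
     / (exp (- (tau * x)) * sqrt (rho ^ 2 - real_eta tau a x ^ 2))).
Proof.
  intros Hr Hh.
  set (E := exp (- (tau * x))). set (h := real_eta tau a x) in *.
  assert (HE : 0 < E) by apply exp_pos.
  assert (Hexp : exp (tau * x) = / E).
  { unfold E. now rewrite exp_Ropp, Rinv_inv. }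
  assert (HD : 0 < rho ^ 2 - h ^ 2) by nra.
  assert (HS : 0 < sqrt (rho ^ 2 - h ^ 2)) by now apply sqrt_lt_R0.
  assert (HS2 : sqrt (rho ^ 2 - h ^ 2) ^ 2 = rho ^ 2 - h ^ 2) by (apply pow2_sqrt; lra).
  set (S := sqrt (rho ^ 2 - h ^ 2)) in *.
  assert (Hdh : is_derive (real_eta tau a) x (tau * h + / E)).
  { unfold real_eta. auto_derive; [trivial |]. unfold h, real_eta. rewrite Hexp. ring. }
  assert (Hu : -1 < h / rho < 1).
  { split; [apply Rlt_div_r | apply Rlt_div_l]; lra. }
  assert (HSu : sqrt (1 - (h / rho)²) = S / rho).
  { unfold S. replace (1 - (h / rho)²) with ((rho ^ 2 - h ^ 2) / rho ^ 2)
      by (unfold Rsqr; field; lra).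
    rewrite sqrt_div_alt by nra. now rewrite sqrt_pow2 by lra. }
  assert (H1 : is_derive (fun t => exp (- (tau * t))) x (- tau * E)).
  { auto_derive; [trivial |]. unfold E. ring. }
  assert (H2 : is_derive (fun t => sqrt (rho ^ 2 - real_eta tau a t ^ 2)) x
                 ((0 - 2 * (tau * h + / E) * h) / (2 * S))).
  { apply (is_derive_sqrt (fun t => rho ^ 2 - real_eta tau a t ^ 2)); [| exact HD].
    apply (is_derive_minus (V := R_NormedModule)).
    - apply (is_derive_const (V := R_NormedModule)).
    - replace (2 * (tau * h + / E) * h)
        with (INR 2 * (tau * h + / E) * real_eta tau a x ^ Nat.pred 2)
        by (fold h; simpl; ring).
      now apply is_derive_pow. }
  assert (H3 : is_derive (fun t => acos (real_eta tau a t / rho)) x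
                 (((tau * h + / E) / rho) * - / (S / rho))).
  { apply (is_derive_comp (V := R_NormedModule) acos (fun t => real_eta tau a t / rho)).
    - rewrite <- HSu. now apply is_derive_acos.
    - unfold Rdiv. apply (is_derive_ext (fun t => / rho * real_eta tau a t)).
      + intros t. apply Rmult_comm.
      + replace ((tau * h + / E) * / rho) with (/ rho * (tau * h + / E)) by ring.
        now apply is_derive_scal. }
  unfold root_phase.
  replace (- _ / _) with
    (tau * ((- tau * E) * S + E * ((0 - 2 * (tau * h + / E) * h) / (2 * S)))
     + ((tau * h + / E) / rho) * - / (S / rho)).
  - apply (is_derive_plus (V := R_NormedModule)); [| exact H3].
    apply (is_derive_scal (fun t => exp (- (tau * t)) * sqrt (rho ^ 2 - real_eta tau a t ^ 2))).
    apply (is_derive_mult (K := R_AbsRing) _ _ _ _ _ H1 H2).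
    intros; apply Rmult_comm.
  - replace (rho ^ 2) with (S ^ 2 + h ^ 2) by lra. field. lra.
Qed.

(** The phase decreases as the real part moves to the right of the imaginary
    axis.  As [real_eta] increases, the interval from [0] to [x] stays inside the
    region where the derivative formula applies, except for its end points. *)
Lemma root_phase_le (tau a rho x : R) :
  0 < tau -> a * tau <= 1 -> 0 < rho -> 0 <= x ->
  - rho <= - a -> real_eta tau a x <= rho ->
  root_phase tau a rho x <= root_phase tau a rho 0.
Proof.
  intros Ht Ha Hr Hx H0 H1.
  assert (Hh0 := real_eta_0 tau a).
  destruct (MVT_gen (root_phase tau a rho) 0 x
    (fun x => - (tau ^ 2 * exp (- (tau * x)) ^ 2 * rho ^ 2
        + 2 * tau * exp (- (tau * x)) * real_eta tau a x + 1)
     / (exp (- (tau * x)) * sqrt (rho ^ 2 - real_eta tau a x ^ 2)))) as [c [Hc Heq]].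
  - rewrite Rmin_left, Rmax_right by lra. intros t Ht'.
    apply is_derive_root_phase; trivial.
    assert (real_eta tau a 0 < real_eta tau a t) by (apply real_eta_increasing; lra).
    assert (real_eta tau a t < real_eta tau a x) by (apply real_eta_increasing; lra).
    lra.
  - intros t _. apply continuity_root_phase.
  - rewrite Rmin_left, Rmax_right in Hc by lra. cbv beta in Heq.
    set (E := exp (- (tau * c))) in *. set (h := real_eta tau a c) in *.
    assert (Hh : - rho <= h <= rho).
    { split; unfold h.
      - destruct (proj1 Hc) as [Hc0 | <-]; [| lra].
        assert (real_eta tau a 0 < real_eta tau a c) by (apply real_eta_increasing; lra). lra.
      - destruct (proj2 Hc) as [Hc0 | ->]; [| lra].
        assert (real_eta tau a c < real_eta tau a x) by (apply real_eta_increasing; lra). lra. }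
    (* The numerator is [(tau E)^2 (rho^2 - h^2) + (tau E h + 1)^2]. *)
    assert (HN : 0 <= tau ^ 2 * E ^ 2 * rho ^ 2 + 2 * tau * E * h + 1).
    { assert (0 <= (tau * E) ^ 2 * (rho ^ 2 - h ^ 2)).
      { apply Rmult_le_pos; [apply pow2_ge_0 | nra]. }
      assert (0 <= (tau * E * h + 1) ^ 2) by apply pow2_ge_0. nra. }
    (* [c] may be an end point, where the square root and, by convention, its
       inverse are zero. *)
    assert (HB : 0 <= / (E * sqrt (rho ^ 2 - h ^ 2))).
    { assert (HD : 0 <= E * sqrt (rho ^ 2 - h ^ 2)).
      { apply Rmult_le_pos; [apply Rlt_le, exp_pos | apply sqrt_pos]. }
      destruct HD as [HD | <-]; [apply Rlt_le, Rinv_0_lt_compat, HD | rewrite Rinv_0; lra]. }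
    unfold Rdiv in Heq. set (N := tau ^ 2 * _ * _ + _ + 1) in *.
    assert (0 <= (N * / (E * sqrt (rho ^ 2 - h ^ 2))) * x) by (repeat apply Rmult_le_pos; lra).
    nra.
Qed.

(** * Roots and their phases *)

Lemma Cexp_plus (z w : C) : Cexp (z + w) = (Cexp z * Cexp w)%C.
Proof.
  destruct z as [x y], w as [u v]. unfold Cexp. simpl.
  rewrite exp_plus, cos_plus, sin_plus. unfold Cmult. simpl. f_equal; ring.
Qed.

Lemma Cexp_opp_l (z : C) : (Cexp (- z) * Cexp z)%C = 1%C.
Proof.
  rewrite <- Cexp_plus. replace (- z + z)%C with (RtoC 0) by ring.
  unfold Cexp. simpl. rewrite exp_0, cos_0, sin_0. unfold RtoC. f_equal; ring.
Qed.

Lemma Cexp_conj (z : C) : Cexp (Cconj z) = Cconj (Cexp z).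
Proof.
  destruct z as [x y]. unfold Cexp, Cconj. simpl. rewrite cos_neg, sin_neg.
  f_equal; ring.
Qed.

Lemma Cmod_Cexp (z : C) : Cmod (Cexp z) = exp (Re z).
Proof.
  unfold Cmod, Cexp. simpl.
  replace (_ + _) with (exp (Re z) ^ 2 * ((sin (Im z))² + (cos (Im z))²)) by (unfold Rsqr; ring).
  rewrite sin2_cos2, Rmult_1_r. apply sqrt_pow2, Rlt_le, exp_pos.
Qed.

Lemma Cconj_RtoC (x : R) : Cconj (RtoC x) = RtoC x.
Proof. unfold Cconj, RtoC. simpl. now rewrite Ropp_0. Qed.

Lemma char_eq_solve (tau a : R) (eta s : C) :
  (s - RtoC a - eta * Cexp (- s * RtoC tau))%C = 0%C <->
  eta = ((s - RtoC a) * Cexp (s * RtoC tau))%C.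
Proof.
  assert (H := Cexp_opp_l (s * RtoC tau)).
  replace (- (s * RtoC tau))%C with (- s * RtoC tau)%C in H by ring.
  split; intros E.
  - replace (s - RtoC a)%C with
      ((s - RtoC a - eta * Cexp (- s * RtoC tau)) + eta * Cexp (- s * RtoC tau))%C by ring.
    rewrite E, Cplus_0_l, <- Cmult_assoc, H. ring.
  - rewrite E, <- Cmult_assoc, (Cmult_comm (Cexp (s * RtoC tau))), H. ring.
Qed.

(** The point of the curve [|s - a| e^(tau Re s) = rho] in the closed upper half
    plane with real part [x]. *)
Definition curve_point (tau a rho x : R) : C :=
  (x, exp (- (tau * x)) * sqrt (rho ^ 2 - real_eta tau a x ^ 2)).

Lemma root_phase_polar (tau a rho x : R) :
  0 < rho -> - rho <= real_eta tau a x <= rho ->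
  ((curve_point tau a rho x - RtoC a) * Cexp (curve_point tau a rho x * RtoC tau))%C
  = (rho * cos (root_phase tau a rho x), rho * sin (root_phase tau a rho x)).
Proof.
  intros Hr Hh. unfold curve_point, root_phase.
  set (h := real_eta tau a x) in *. set (E := exp (- (tau * x))).
  assert (HE : 0 < E) by apply exp_pos.
  assert (Hexp : exp (tau * x) = / E).
  { unfold E. now rewrite exp_Ropp, Rinv_inv. }
  assert (Hx : x - a = E * h) by (unfold h, real_eta; rewrite Hexp; field; lra).
  assert (Hu : -1 <= h / rho <= 1).
  { split; [apply Rle_div_r | apply Rle_div_l]; lra. }
  assert (Hs : sqrt (rho ^ 2 - h ^ 2) = rho * sin (acos (h / rho))).
  { rewrite sin_acos by trivial.
    replace (rho ^ 2 - h ^ 2) with (rho ^ 2 * (1 - (h / rho)²)) by (unfold Rsqr; field; lra).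
    rewrite sqrt_mult_alt by apply pow2_ge_0. now rewrite sqrt_pow2 by lra. }
  assert (Hc : h = rho * cos (acos (h / rho))).
  { rewrite cos_acos by trivial. field. lra. }
  rewrite Hs. set (S := rho * sin (acos (h / rho))) in *.
  rewrite (cos_plus (tau * (E * S))), (sin_plus (tau * (E * S))).
  unfold Cexp, Cmult, Cminus, Cplus, Copp, RtoC. simpl.
  replace (x * tau - E * S * 0) with (tau * x) by ring.
  replace (x * 0 + E * S * tau) with (tau * (E * S)) by ring.
  rewrite Hexp. replace (x + - a) with (E * h) by lra.
  set (ct := cos (tau * (E * S))). set (st := sin (tau * (E * S))).
  replace (rho * (ct * cos (acos (h / rho)) - st * sin (acos (h / rho))))
    with (ct * (rho * cos (acos (h / rho))) - st * (rho * sin (acos (h / rho)))) by ring.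
  replace (rho * (st * cos (acos (h / rho)) + ct * sin (acos (h / rho))))
    with (st * (rho * cos (acos (h / rho))) + ct * (rho * sin (acos (h / rho)))) by ring.
  rewrite <- Hc. fold S. f_equal; field; lra.
Qed.

(** As [a] is real, conjugating [eta] conjugates the roots; this reduces the
    study of roots to the closed upper half plane. *)
Lemma Cconj_eta_of_root (tau a : R) (s : C) :
  Cconj ((s - RtoC a) * Cexp (s * RtoC tau)) =
  ((Cconj s - RtoC a) * Cexp (Cconj s * RtoC tau))%C.
Proof.
  now rewrite Cmult_conj, Cminus_conj, <- Cexp_conj, Cmult_conj, !Cconj_RtoC.
Qed.

Lemma Arg_polar (z : C) : z <> 0%C ->
  0 <= Rabs (Arg z) <= PI /\ Re z = Cmod z * cos (Rabs (Arg z)) /\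
  Rabs (Im z) = Cmod z * sin (Rabs (Arg z)).
Proof.
  intros Hz. destruct (Arg_spec z Hz) as [Hb Hp].
  assert (Hm : 0 < Cmod z) by now apply Cmod_gt_0.
  assert (HA : 0 <= Rabs (Arg z) <= PI).
  { split; [apply Rabs_pos | apply Rabs_le; lra]. }
  split; [exact HA |].
  assert (Hs : 0 <= sin (Rabs (Arg z))) by (apply sin_ge_0; lra).
  split.
  - rewrite Hp at 1. simpl. unfold Rabs. destruct Rcase_abs; [now rewrite cos_neg | trivial].
  - rewrite Hp at 1. simpl. rewrite Rabs_mult, Rabs_pos_eq by lra. f_equal.
    revert Hs. unfold Rabs at 1 3. destruct (Rcase_abs (Arg z)); intros Hs.
    + rewrite sin_neg in *. apply Rabs_left1. lra.
    + apply Rabs_pos_eq, Hs.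
Qed.

(** The modulus of the equation fixes [|Im s|], so [s] or its conjugate is the
    [curve_point] over [Re s]; the real parts of the two sides give the equation
    between cosines.  Comparing cosines rather than angles removes both the
    ambiguity modulo [2 PI] and the sign of the argument. *)
Lemma root_on_phase (tau a : R) (s eta : C) :
  eta <> 0%C -> eta = ((s - RtoC a) * Cexp (s * RtoC tau))%C ->
  - Cmod eta <= real_eta tau a (Re s) <= Cmod eta /\
  cos (root_phase tau a (Cmod eta) (Re s)) = cos (Rabs (Arg eta)).
Proof.
  intros Hz Heq.
  assert (Hm : 0 < Cmod eta) by now apply Cmod_gt_0.
  assert (Hmod : Cmod eta = Cmod (s - RtoC a) * exp (tau * Re s)).
  { rewrite Heq at 1. rewrite Cmod_mult, Cmod_Cexp. destruct s. simpl. do 2 f_equal. ring. }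
  set (rho := Cmod eta) in *. set (x := Re s) in *. set (h := real_eta tau a x).
  set (E := exp (- (tau * x))).
  assert (HE : 0 < E) by apply exp_pos.
  assert (Hexp : exp (tau * x) = / E).
  { unfold E. now rewrite exp_Ropp, Rinv_inv. }
  assert (Hx : x - a = E * h) by (unfold h, real_eta; rewrite Hexp; field; lra).
  assert (Hsq : Cmod (s - RtoC a) ^ 2 = (x - a) ^ 2 + Im s ^ 2).
  { unfold Cmod. rewrite pow2_sqrt; [destruct s; simpl; unfold x; simpl; ring |].
    apply Rplus_le_le_0_compat; apply pow2_ge_0. }
  assert (HIm : Im s ^ 2 = E ^ 2 * (rho ^ 2 - h ^ 2)).
  { replace (Im s ^ 2) with (Cmod (s - RtoC a) ^ 2 - (x - a) ^ 2) by lra.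
    rewrite Hx, Hmod, Hexp. field. lra. }
  assert (HD : 0 <= rho ^ 2 - h ^ 2).
  { apply Rmult_le_reg_l with (E ^ 2); [nra |]. rewrite Rmult_0_r, <- HIm. apply pow2_ge_0. }
  assert (Hh : - rho <= h <= rho) by nra.
  split; [exact Hh |].
  assert (HA : Rabs (Im s) = E * sqrt (rho ^ 2 - h ^ 2)).
  { rewrite <- sqrt_Rsqr_abs. replace ((Im s)²) with (Im s ^ 2) by (unfold Rsqr; ring).
    rewrite HIm, sqrt_mult_alt by apply pow2_ge_0. rewrite sqrt_pow2 by lra. trivial. }
  assert (Hpol := root_phase_polar tau a rho x Hm Hh). unfold curve_point in Hpol.
  fold h E in Hpol. rewrite <- HA in Hpol.
  destruct (Arg_polar eta Hz) as [_ [HRe _]]. fold rho in HRe.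
  apply Rmult_eq_reg_l with rho; [| lra]. rewrite <- HRe.
  transitivity (Re (((x, Rabs (Im s)) - RtoC a) * Cexp ((x, Rabs (Im s)) * RtoC tau))%C).
  { now rewrite Hpol. }
  unfold Rabs. destruct Rcase_abs.
  - replace (x, - Im s) with (Cconj s) by reflexivity.
    rewrite <- Cconj_eta_of_root, <- Heq. reflexivity.
  - replace (x, Im s) with s by now destruct s. now rewrite <- Heq.
Qed.

(** The [curve_point] over [x] is a root for [eta] or for its conjugate, according
    to the sign of [Im eta]. *)
Lemma phase_gives_root (tau a x : R) (eta : C) :
  eta <> 0%C -> - Cmod eta <= real_eta tau a x <= Cmod eta ->
  root_phase tau a (Cmod eta) x = Rabs (Arg eta) ->
  exists s : C, Re s = x /\ eta = ((s - RtoC a) * Cexp (s * RtoC tau))%C.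
Proof.
  intros Hz Hh Hphi.
  assert (Hm : 0 < Cmod eta) by now apply Cmod_gt_0.
  assert (Hpol := root_phase_polar tau a _ x Hm Hh). rewrite Hphi in Hpol.
  destruct (Arg_polar eta Hz) as [_ [HRe HIm]]. rewrite <- HRe, <- HIm in Hpol.
  set (s := curve_point tau a (Cmod eta) x) in Hpol.
  destruct (Rle_dec 0 (Im eta)) as [Hi | Hi].
  - exists s. split; [reflexivity |]. rewrite Hpol, Rabs_pos_eq by exact Hi. now destruct eta.
  - exists (Cconj s). split; [reflexivity |].
    rewrite <- Cconj_eta_of_root, Hpol, Rabs_left by lra. destruct eta. unfold Cconj. simpl.
    now rewrite Ropp_involutive.
Qed.

Lemma root_phase_0 (tau a rho : R) :
  root_phase tau a rho 0 = tau * sqrt (rho ^ 2 - a ^ 2) + acos (- a / rho).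
Proof.
  unfold root_phase. rewrite real_eta_0, Rmult_0_r, Ropp_0, exp_0.
  replace ((- a) ^ 2) with (a ^ 2) by ring. ring.
Qed.

(** * The stability criterion *)

Lemma continuity_ivt (f : R -> R) (x y v : R) :
  continuity f -> x <= y -> f x <= v <= f y \/ f y <= v <= f x ->
  exists z, x <= z <= y /\ f z = v.
Proof.
  intros Hf Hxy Hv.
  destruct (IVT_gen f x y v Hf) as [z [Hz Hfz]].
  - destruct Hv as [Hv | Hv]; [rewrite Rmin_left, Rmax_right | rewrite Rmin_right, Rmax_left]; lra.
  - exists z. rewrite Rmin_left, Rmax_right in Hz by lra. now split.
Qed.

(** Let [X >= 0] be the point with [real_eta tau a X = rho], where the phase is
    [0].  Going from [X] to the left, the phase reaches its value at [0] on the
    imaginary axis when [a <= rho]; otherwise the curve meets the real axis at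
    some [Y] with [real_eta tau a Y = - rho], where the phase is [PI].  In both
    cases the phase takes the value [Rabs (Arg eta)] on the way. *)
Lemma exists_unstable_root (tau a : R) (eta : C) :
  0 < tau -> a * tau <= 1 -> eta <> 0%C -> - a <= Cmod eta ->
  Rabs (Arg eta) <= root_phase tau a (Cmod eta) 0 ->
  exists s : C, 0 <= Re s /\ eta = ((s - RtoC a) * Cexp (s * RtoC tau))%C.
Proof.
  intros Ht Ha Hz Har Hphi.
  assert (Hm : 0 < Cmod eta) by now apply Cmod_gt_0.
  destruct (Arg_polar eta Hz) as [HA _].
  set (rho := Cmod eta) in *.
  assert (Hmono : forall x y, 0 <= x -> x <= y -> real_eta tau a x <= real_eta tau a y).
  { intros x y Hx [Hxy | ->]; [| lra]. apply Rlt_le, real_eta_increasing; lra. }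
  assert (HX : exists X, 0 <= X /\ real_eta tau a X = rho).
  { (* [M - a >= rho] and [M >= 0], so [real_eta tau a M >= rho]. *)
    set (M := Rmax a 0 + rho).
    assert (Hmax := Rmax_l a 0). assert (Hmax' := Rmax_r a 0).
    destruct (continuity_ivt (real_eta tau a) 0 M rho) as [X [HX Hr]].
    - apply continuity_real_eta.
    - unfold M. lra.
    - left. rewrite real_eta_0. split; [lra |].
      unfold real_eta. assert (He : 1 <= exp (tau * M)).
      { rewrite <- exp_0. assert (0 <= tau * M) by (apply Rmult_le_pos; unfold M; lra).
        destruct H as [H | <-]; [apply Rlt_le, exp_increasing, H | lra]. }
      assert (rho <= M - a) by (unfold M; lra). nra.
    - exists X. split; [lra | trivial]. }
  destruct HX as [X [HX0 HX]].
  assert (HpX : root_phase tau a rho X = 0).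
  { unfold root_phase. rewrite HX. replace (rho ^ 2 - rho ^ 2) with 0 by ring.
    rewrite sqrt_0. replace (rho / rho) with 1 by (field; lra). rewrite acos_1. ring. }
  assert (HY : exists Y, 0 <= Y <= X /\ - rho <= real_eta tau a Y <= rho /\
                 Rabs (Arg eta) <= root_phase tau a rho Y).
  { destruct (Rle_dec (- rho) (- a)) as [Hle | Hgt].
    - exists 0. rewrite real_eta_0. repeat split; lra.
    - destruct (continuity_ivt (real_eta tau a) 0 X (- rho)) as [Y [HY Hr]].
      + apply continuity_real_eta.
      + lra.
      + left. rewrite real_eta_0. lra.
      + exists Y. split; [lra |]. split; [lra |].
        unfold root_phase. rewrite Hr. replace (rho ^ 2 - (- rho) ^ 2) with 0 by ring.
        rewrite sqrt_0. replace (- rho / rho) with (- (1)) by (field; lra).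
        rewrite acos_opp, acos_1. lra. }
  destruct HY as [Y [HY0 [HY HpY]]].
  destruct (continuity_ivt (root_phase tau a rho) Y X (Rabs (Arg eta))) as [x [Hx Hpx]].
  - apply continuity_root_phase.
  - lra.
  - right. lra.
  - destruct (phase_gives_root tau a x eta Hz) as [s [Hs Hr]].
    + fold rho. split.
      * apply Rle_trans with (real_eta tau a Y); [lra | apply Hmono; lra].
      * rewrite <- HX. apply Hmono; lra.
    + exact Hpx.
    + exists s. split; [lra | exact Hr].
Qed.

(** The saturated value: for [Cmod eta < a] the criterion below asks for an
    argument beyond [PI], so there is always an unstable root. *)
Lemma root_phase_0_eq_PI (tau a rho : R) :
  0 < rho -> rho <= a -> root_phase tau a rho 0 = PI.
Proof.
  intros Hr Ha. rewrite root_phase_0, sqrt_neg_0 by nra.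
  replace (- a / rho) with (- (a / rho)) by (field; lra).
  rewrite acos_opp. unfold acos.
  assert (1 <= a / rho) by (apply Rle_div_r; lra).
  destruct Rle_dec; [lra |]. destruct Rle_dec; lra.
Qed.

(** The three cases in the definition of [Lambda] are one criterion: either
    [eta] is too small for the delayed term to compensate [a < 0], or the
    argument of [eta] exceeds the phase of a root on the imaginary axis.  In the
    second case a root with [Re s >= 0] would have a phase between [0] and
    [PI] with the same cosine as the strictly larger [Rabs (Arg eta)]. *)
Lemma stable_iff (tau a : R) (eta : C) :
  0 < tau -> a * tau <= 1 ->
  (forall s : C, (s - RtoC a - eta * Cexp (- s * RtoC tau))%C = 0%C -> left_half_plane s) <->
  Cmod eta < - a \/ (eta <> 0%C /\ root_phase tau a (Cmod eta) 0 < Rabs (Arg eta)).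
Proof.
  intros Ht Ha. split.
  - intros Hst. destruct (Rlt_dec (Cmod eta) (- a)) as [Hlt | Hge]; [now left |].
    right. destruct (Ceq_dec eta 0%C) as [Hz | Hz].
    + exfalso. rewrite Hz, Cmod_0 in Hge.
      assert (H : left_half_plane (RtoC a)).
      { apply Hst. rewrite Hz. ring. }
      unfold left_half_plane in H. simpl in H. lra.
    + split; [exact Hz |]. apply Rnot_le_lt. intros Hle.
      destruct (exists_unstable_root tau a eta) as [s [Hs Hr]]; trivial; [lra |].
      apply char_eq_solve, Hst in Hr. unfold left_half_plane in Hr. lra.
  - intros H s Hs. apply char_eq_solve in Hs. unfold left_half_plane.
    apply Rnot_le_lt. intros Hx.
    destruct H as [Hlt | [Hz Hphi]].
    + assert (Hmod : Cmod eta = Cmod (s - RtoC a) * exp (tau * Re s)).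
      { rewrite Hs at 1. rewrite Cmod_mult, Cmod_Cexp. destruct s. simpl. do 2 f_equal. ring. }
      assert (Hre := re_le_Cmod (s - RtoC a)).
      assert (Hre' := Rle_abs (Re (s - RtoC a))).
      assert (Hsub : Re (s - RtoC a) = Re s - a) by (destruct s; reflexivity).
      assert (1 <= exp (tau * Re s)).
      { assert (H := exp_ineq1_le (tau * Re s)).
        assert (0 <= tau * Re s) by (apply Rmult_le_pos; lra). lra. }
      assert (Hge := Cmod_ge_0 (s - RtoC a)). nra.
    + assert (Hm : 0 < Cmod eta) by now apply Cmod_gt_0.
      destruct (Arg_polar eta Hz) as [HA _].
      destruct (root_on_phase tau a s eta Hz Hs) as [Hh Hcos].
      destruct (Rle_dec a (Cmod eta)) as [Hle | Hgt].
      * assert (Hle2 : root_phase tau a (Cmod eta) (Re s) <= root_phase tau a (Cmod eta) 0).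
        { apply root_phase_le; trivial; lra. }
        assert (H0 : 0 <= root_phase tau a (Cmod eta) (Re s)).
        { unfold root_phase. apply Rplus_le_le_0_compat; [| apply acos_bound].
          apply Rmult_le_pos; [lra |].
          apply Rmult_le_pos; [apply Rlt_le, exp_pos | apply sqrt_pos]. }
        assert (cos (Rabs (Arg eta)) < cos (root_phase tau a (Cmod eta) (Re s))).
        { apply cos_decreasing_1; lra. }
        lra.
      * rewrite root_phase_0_eq_PI in Hphi; lra.
Qed.

(** * Comparison with the sets Lambda *)

Lemma acos_div_hypot (a r : R) :
  0 < a -> a <= r -> acos (a / r) = atan (/ a * sqrt (r ^ 2 - a ^ 2)).
Proof.
  intros Ha Hr.
  rewrite acos_atan by (apply Rdiv_lt_0_compat; lra). f_equal.
  replace (1 - (a / r)²) with ((r ^ 2 - a ^ 2) / r ^ 2) by (unfold Rsqr; field; lra).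
  rewrite sqrt_div_alt by nra. rewrite sqrt_pow2 by lra. field. lra.
Qed.

Lemma root_phase_0_neg (tau a : R) (eta : C) :
  a < 0 -> - a <= Cmod eta -> root_phase tau a (Cmod eta) 0 = phase tau a eta.
Proof.
  intros Ha Hr. rewrite root_phase_0. unfold phase. f_equal.
  rewrite acos_div_hypot by lra. f_equal.
  replace ((- a) ^ 2) with (a ^ 2) by ring. field. lra.
Qed.

Lemma root_phase_0_pos (tau a : R) (eta : C) :
  0 < a -> a <= Cmod eta -> root_phase tau a (Cmod eta) 0 = phase tau a eta + PI.
Proof.
  intros Ha Hr. rewrite root_phase_0. unfold phase.
  replace (- a / Cmod eta) with (- (a / Cmod eta)) by (field; lra).
  rewrite acos_opp, acos_div_hypot by lra.
  replace (- (1 / a) * sqrt (Cmod eta ^ 2 - a ^ 2))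
    with (- (/ a * sqrt (Cmod eta ^ 2 - a ^ 2))) by (field; lra).
  rewrite atan_opp. ring.
Qed.

(** In the variable [w = sqrt (|eta|^2 - a^2)] the phase is continuous and
    unbounded, so [eta_pi] exists as soon as the phase at [eta] is below the
    prescribed value. *)
Lemma phase_attains (tau a v : R) (eta : C) :
  0 < tau -> Rabs a <= Cmod eta -> phase tau a eta < v -> v <= PI ->
  exists eta_pi : C, phase tau a eta_pi = v /\ Cmod eta < Cmod eta_pi.
Proof.
  intros Ht Ha Hlt Hv. unfold phase in Hlt.
  set (w0 := sqrt (Cmod eta ^ 2 - a ^ 2)) in *.
  assert (Hw0 : 0 <= w0) by apply sqrt_pos.
  assert (Ha2 : a ^ 2 <= Cmod eta ^ 2).
  { rewrite <- (pow2_abs a). apply pow_incr. split; [apply Rabs_pos | exact Ha]. }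
  assert (Hw2 : w0 ^ 2 = Cmod eta ^ 2 - a ^ 2) by (apply pow2_sqrt; lra).
  assert (Hpi := PI_RGT_0).
  assert (HK : 0 < 2 * PI / tau) by (apply Rdiv_lt_0_compat; lra).
  (* The step [2 * PI / tau] adds [2 * PI] to the linear term, and the arctangent
     is greater than [- PI / 2], so the value at the right end is above [PI]. *)
  destruct (continuity_ivt (fun w => tau * w + atan (- (1 / a) * w)) w0 (w0 + 2 * PI / tau) v)
    as [w [Hw Hfw]].
  - intros x. apply derivable_continuous_pt. apply ex_derive_Reals_0. now auto_derive.
  - lra.
  - left. split; [lra |].
    assert (Hb := atan_bound (- (1 / a) * (w0 + 2 * PI / tau))).
    assert (0 <= tau * w0) by (apply Rmult_le_pos; lra).
    replace (tau * (w0 + 2 * PI / tau)) with (tau * w0 + 2 * PI) by (field; lra). lra.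
  - assert (Hww : w0 < w).
    { destruct (proj1 Hw) as [H | H]; [exact H |]. rewrite <- H in Hfw. lra. }
    exists (RtoC (sqrt (w ^ 2 + a ^ 2))).
    assert (Hm : Cmod (RtoC (sqrt (w ^ 2 + a ^ 2))) = sqrt (w ^ 2 + a ^ 2)).
    { rewrite Cmod_R. apply Rabs_pos_eq, sqrt_pos. }
    assert (Hp : 0 <= w ^ 2 + a ^ 2) by nra.
    split.
    + unfold phase. rewrite Hm, pow2_sqrt by exact Hp.
      replace (w ^ 2 + a ^ 2 - a ^ 2) with (w ^ 2) by ring.
      now rewrite sqrt_pow2 by lra.
    + rewrite Hm, <- (sqrt_pow2 (Cmod eta)) by apply Cmod_ge_0.
      apply sqrt_lt_1; nra.
Qed.

(** On the imaginary axis the phase is at least [acos (- a / |eta|)], so a larger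
    argument forces [cos (Arg eta) < - a / |eta|]. *)
Lemma Re_lt_of_phase (tau a : R) (eta : C) :
  0 < tau -> eta <> 0%C -> Rabs a <= Cmod eta ->
  root_phase tau a (Cmod eta) 0 < Rabs (Arg eta) -> Re eta + a < 0.
Proof.
  intros Ht Hz Ha Hphi.
  assert (Hm : 0 < Cmod eta) by now apply Cmod_gt_0.
  destruct (Arg_polar eta Hz) as [HA [HRe _]].
  rewrite root_phase_0 in Hphi.
  assert (Hu : -1 <= - a / Cmod eta <= 1).
  { apply Rabs_le_between in Ha. split; [apply Rle_div_r | apply Rle_div_l]; lra. }
  assert (Hb := acos_bound (- a / Cmod eta)).
  assert (0 <= tau * sqrt (Cmod eta ^ 2 - a ^ 2)) by (apply Rmult_le_pos; [lra | apply sqrt_pos]).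
  assert (Hc : cos (Rabs (Arg eta)) < cos (acos (- a / Cmod eta))) by (apply cos_decreasing_1; lra).
  rewrite cos_acos in Hc by exact Hu.
  rewrite HRe. apply (Rmult_lt_compat_l (Cmod eta)) in Hc; [| exact Hm].
  replace (Cmod eta * (- a / Cmod eta)) with (- a) in Hc by (field; lra). lra.
Qed.

(** The conditions of [Lambda] on [Re eta] and on [eta_pi] follow from the one on
    the argument: since [Rabs (Arg eta) <= PI], it bounds the phase by [PI] for
    [a < 0] and by [0] for [a > 0], and [|eta|] by [PI / (2 tau)] for [a = 0]; then [phase_attains] and [Re_lt_of_phase]
    apply. *)
Lemma Lambda_iff (tau a : R) (eta : C) :
  0 < tau -> a <= 1 / tau ->
  Lambda tau a eta <->
  Cmod eta < - a \/ (eta <> 0%C /\ root_phase tau a (Cmod eta) 0 < Rabs (Arg eta)).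
Proof.
  intros Ht Hat. assert (Hpi := PI_RGT_0).
  assert (Hnz : 0 < Cmod eta -> eta <> 0%C).
  { intros Hm ->. rewrite Cmod_0 in Hm. lra. }
  assert (Hdisc : a < 0 -> (Defs.disc (Rabs a) eta <-> Cmod eta < - a)).
  { intros Ha. unfold Defs.disc. now rewrite Rabs_left. }
  split.
  - intros [[Ha HL] | [[Ha HL] | [Ha HL]]].
    + destruct HL as [[Hd [_ [_ Harg]]] | Hd]; [| left; now apply Hdisc].
      right. rewrite Hdisc in Hd by exact Ha. rewrite root_phase_0_neg by lra.
      split; [apply Hnz |]; lra.
    + destruct HL as [Hz [_ [_ Harg]]]. right. split; [exact Hz |].
      rewrite Ha, root_phase_0.
      replace (- 0 / Cmod eta) with 0 by (unfold Rdiv; ring). rewrite acos_0.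
      replace (Cmod eta ^ 2 - 0 ^ 2) with (Cmod eta ^ 2) by ring.
      rewrite sqrt_pow2 by apply Cmod_ge_0. lra.
    + destruct HL as [HRe [_ Harg]]. right.
      assert (Hle : a <= Cmod eta).
      { assert (H := re_le_Cmod eta). rewrite Rabs_left in H; lra. }
      rewrite root_phase_0_pos by lra. split; [apply Hnz |]; lra.
  - intros [Hlt | [Hz Hphi]].
    + left. assert (H := Cmod_ge_0 eta). split; [lra |]. right. apply Hdisc; lra.
    + assert (Hm : 0 < Cmod eta) by now apply Cmod_gt_0.
      destruct (Arg_polar eta Hz) as [HA _].
      destruct (Rtotal_order a 0) as [Ha | [Ha | Ha]].
      * left. split; [exact Ha |].
        destruct (Rlt_dec (Cmod eta) (- a)) as [Hd | Hd]; [right; now apply Hdisc |].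
        assert (Habs : Rabs a <= Cmod eta) by (rewrite Rabs_left; lra).
        left. split; [rewrite Hdisc; lra |].
        split; [now apply (Re_lt_of_phase tau) |].
        rewrite root_phase_0_neg in Hphi by lra. split; [| lra].
        apply phase_attains; lra.
      * right; left. split; [exact Ha |].
        assert (HRe : Re eta + a < 0).
        { apply (Re_lt_of_phase tau); trivial. rewrite Ha, Rabs_R0. lra. }
        rewrite Ha, root_phase_0 in Hphi.
        replace (- 0 / Cmod eta) with 0 in Hphi by (unfold Rdiv; ring). rewrite acos_0 in Hphi.
        replace (Cmod eta ^ 2 - 0 ^ 2) with (Cmod eta ^ 2) in Hphi by ring.
        rewrite sqrt_pow2 in Hphi by lra.
        split; [exact Hz |]. split; [lra |]. split; [| lra].
        apply Rlt_div_r; [lra |]. lra.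
      * right; right. split; [lra |].
        assert (Hle : a <= Cmod eta).
        { destruct (Rle_dec a (Cmod eta)); [trivial |].
          rewrite root_phase_0_eq_PI in Hphi; lra. }
        assert (Habs : Rabs a <= Cmod eta) by (rewrite Rabs_pos_eq; lra).
        split; [now apply (Re_lt_of_phase tau) |].
        rewrite root_phase_0_pos in Hphi by lra. split; [| lra].
        destruct (phase_attains tau a 0 eta) as [p [Hp1 Hp2]]; try lra.
        exists p. repeat split; lra.
Qed.

Theorem corollary9 (tau : R) (lambda gamma eta : C) (a b : R)
    (htau : 0 < tau)
    (hlambda : lambda = (RtoC a + Ci * RtoC b)%C)
    (ha : a <= 1 / tau) :
  ((forall s : C,
      (s - RtoC a - eta * Cexp (- s * RtoC tau))%C = 0%C -> left_half_plane s)
   <-> Lambda tau a eta)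
  /\
  ((forall s : C,
      ((s - lambda - gamma * Cexp (- s * RtoC tau))%C = 0%C -> left_half_plane s) /\
      ((s - Cconj lambda - Cconj gamma * Cexp (- s * RtoC tau))%C = 0%C ->
         left_half_plane s))
   <-> Lambda tau a (gamma * Cexp (- Ci * RtoC b * RtoC tau))%C).
Proof.
  assert (Hat : a * tau <= 1).
  { apply (Rmult_le_compat_r tau) in ha; [| lra].
    replace (1 / tau * tau) with 1 in ha by (field; lra). exact ha. }
  assert (Hi : forall z : C,
    (forall s : C,
      (s - RtoC a - z * Cexp (- s * RtoC tau))%C = 0%C -> left_half_plane s)
    <-> Lambda tau a z).
  { intros z. rewrite Lambda_iff by assumption. now apply stable_iff. }
  split; [apply Hi |]. rewrite <- Hi.
  (* [s + i b] solves the equation with coefficients [lambda] and [gamma] exactly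
     when [s] solves the one with [a] and [gamma * exp (- i b tau)]. *)
  assert (Hshift : forall s : C,
    (s + Ci * RtoC b - lambda - gamma * Cexp (- (s + Ci * RtoC b) * RtoC tau))%C =
    (s - RtoC a - gamma * Cexp (- Ci * RtoC b * RtoC tau) * Cexp (- s * RtoC tau))%C).
  { intros s. rewrite hlambda, <- Cmult_assoc, <- Cexp_plus.
    replace (- Ci * RtoC b * RtoC tau + - s * RtoC tau)%C
      with (- (s + Ci * RtoC b) * RtoC tau)%C by ring. ring. }
  assert (Hre : forall s : C, Re (s + Ci * RtoC b) = Re s).
  { intros [x y]. simpl. ring. }
  split.
  - intros H s Hs. rewrite <- Hshift in Hs. apply H in Hs.
    unfold left_half_plane in *. now rewrite Hre in Hs.
  - intros H.
    assert (H1 : forall s : C,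
      (s - lambda - gamma * Cexp (- s * RtoC tau))%C = 0%C -> left_half_plane s).
    { intros s Hs. specialize (H (s - Ci * RtoC b)%C). rewrite <- Hshift in H.
      unfold left_half_plane in *. rewrite <- Hre in H.
      replace (s - Ci * RtoC b + Ci * RtoC b)%C with s in H by ring. now apply H. }
    intros s. split; [apply H1 |]. intros Hs.
    change (left_half_plane (Cconj s)). apply H1.
    rewrite <- (Cconj_conj lambda), <- (Cconj_conj gamma).
    replace (- Cconj s * RtoC tau)%C with (Cconj (- s * RtoC tau)).
    + rewrite Cexp_conj, <- Cmult_conj, <- !Cminus_conj, Hs. apply Cconj_RtoC.
    + now rewrite Cmult_conj, Copp_conj, Cconj_RtoC.
Qed.
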